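(* Work in homotopy type theory with a weak Tarski universe, and let $V$ be the type of iterative sets with the type-theoretic interpretation $\llbracket\cdot\rrbracket$ of set-theoretic formulae. Then the regular extension axiom (REA), ''every set is a subset of a regular set'', is valid in the interpretation.
   Context: Ambient theory. Homotopy type theory with a weak Tarski universe: intensional Martin-Löf type theory with dependent products $\Pi$ (with definitional $\beta$ and $\eta$), dependent sums $\Sigma$ (projections $\mathsf p,\mathsf q$), identity types $Id$, binary sums $+$, finite types $\mathbf N_k$, natural numbers $\mathbf N$, $W$-types, and function extensionality (for $f,g:(\Pi x:A)B(x)$ the canonical map $Id(f,g)\to(\Pi x:A)Id(f(x),g(x))$ is an equivalence). $\mathit{Equiv}(A,B)$ is the type of maps $f:A\to B$ with a left inverse and a right inverse up to pointwise identity. The weak Tarski universe is a type $U$ of names with a family $El(a)$ ($a:U$), closed under names for all type constructors: $\pi(a,b),\sigma(a,b),w(a,b):U$ for $a:U$, $b(x):U$ ($x:El(a)$); $i_a(b,c):U$ for $b,c:El(a)$; $plus(a,b):U$; $n:U$; $n_k:U$. Instead of definitional equalities there are only given equivalences: $El(\pi(a,b))\simeq(\Pi x:El(a))El(b(x))$, $El(\sigma(a,b))\simeq(\Sigma x:El(a))El(b(x))$, $El(w(a,b))\simeq(Wx:El(a))El(b(x))$, $El(i_a(b,c))\simeq Id_{El(a)}(b,c)$, $El(plus(a,b))\simeq El(a)+El(b)$, $El(n)\simeq\mathbf N$, $El(n_k)\simeq\mathbf N_k$. (Homotopy type theory also includes univalence: the canonical map $Id_U(a,b)\to\mathit{Equiv}(El(a),El(b))$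 is an equivalence.) Iterative sets. $V:=(Wx:U)El(x)$, with canonical elements $\mathsf{sup}(a,f)$, $a:U$, $f:El(a)\to V$. For $\alpha:V$ there are $\overline\alpha:U$ and $\tilde\alpha:El(\overline\alpha)\to V$, defined by recursion, with $\overline{\mathsf{sup}(a,f)}=a$ and $\widetilde{\mathsf{sup}(a,f)}=f$. Extensional equality $\alpha\doteq\beta$ is the type defined by double transfinite recursion on $V$ by $(\mathsf{sup}(a,f)\doteq\mathsf{sup}(b,g)):=(\Pi x:El(a))(\Sigma y:El(b))(f(x)\doteq g(y))\times(\Pi y:El(b))(\Sigma x:El(a))(f(x)\doteq g(y))$. Language and interpretation. The language of CZF is first order, with logical symbols $\bot,\wedge,\vee,\Rightarrow,\forall x,\exists x$, primitive restricted quantifiers $\forall x\in y$, $\exists x\in y$, and relation symbols $\in$ and equality (written $\doteq$). $\mathcal L_V$ adds a constant for each $\alpha:V$. The interpretation is: $\llbracket\alpha\doteq\beta\rrbracket=(\alpha\doteq\beta)$; $\llbracket\alpha\in\beta\rrbracket=(\Sigma y:El(\overline\beta))(\alpha\doteq\tilde\beta(y))$; $\llbracket\bot\rrbracket=\mathbf N_0$; $\Rightarrow,\wedge,\vee$ are interpreted by $\to,\times,+$; $\llbracket(\forall x\in\alpha)\phi(x)\rrbracket=(\Pi x:El(\overline\alpha))\llbracket\phi(\tilde\alpha(x))\rrbracket$; $\llbracket(\exists x\in\alpha)\phi(x)\rrbracket=(\Sigma x:El(\overline\alpha))\llbracket\phi(\tilde\alpha(x))\rrbracket$; $\llbracket\forall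 x\,\phi(x)\rrbracket=(\Pi\alpha:V)\llbracket\phi(\alpha)\rrbracket$; $\llbracket\exists x\,\phi(x)\rrbracket=(\Sigma\alpha:V)\llbracket\phi(\alpha)\rrbracket$. A formula is valid iff the interpretation of its universal closure is inhabited. Set-theoretic notions. $\alpha\subseteq\beta$ means $(\forall x\in\alpha)(x\in\beta)$. $\langle x,y\rangle$ is the ordered pair $\{\{x\},\{x,y\}\}$. A set $A$ is regular iff it is transitive (every element of $A$ is a subset of $A$) and for every $a\in A$ and every set $R\subseteq a\times A$, if $(\forall x\in a)\exists y\,\langle x,y\rangle\in R$, then there is $b\in A$ such that $(\forall x\in a)(\exists y\in b)\,\langle x,y\rangle\in R\wedge(\forall y\in b)(\exists x\in a)\,\langle x,y\rangle\in R$. *)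

(* Defs.v *)
(* Rocq's own predicative type theory plays the role of the ambient
   intensional type theory.  Everything is Type-valued, in particular
   the identity type, so that no truncation (Prop) is involved. *)
From Stdlib Require Fin.
Set Implicit Arguments.

Declare Scope czf_scope.
Delimit Scope czf_scope with czf.

Inductive Id (A : Type) (x : A) : A -> Type := refl : Id x x.

Inductive W (A : Type) (B : A -> Type) : Type :=
  sup : forall a : A, (B a -> W B) -> W B.

Definition IsEquiv (A B : Type) (f : A -> B) : Type :=
  ({g : B -> A & forall x, Id (g (f x)) x} *
   {h : B -> A & forall y, Id (f (h y)) y})%type.

Definition Equiv (A B : Type) : Type := {f : A -> B & IsEquiv f}.

Definition happly (A : Type) (B : A -> Type) (f g : forall x, B x)
    (p : Id f g) : forall x, Id (f x) (g x) :=
  match p with refl _ => fun x => refl (f x) end.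

Definition Funext : Type :=
  forall (A : Type) (B : A -> Type) (f g : forall x, B x),
    IsEquiv (@happly A B f g).

(* Univalence is not imposed: univalent weak Tarski universes are a special
   case.  As a premise it would be consistent with pure Rocq, but refutable from
   the usual axiom of proof irrelevance: Id is a retract of the Prop-valued
   equality, whereas the name of N_2 has a nontrivial self-equivalence. *)
Record WeakTarskiUniverse : Type := {
  U : Type;
  El : U -> Type;
  pi_name : forall a : U, (El a -> U) -> U;
  sigma_name : forall a : U, (El a -> U) -> U;
  w_name : forall a : U, (El a -> U) -> U;
  id_name : forall a : U, El a -> El a -> U;
  plus_name : U -> U -> U;
  nat_name : U;
  fin_name : nat -> U;
  El_pi : forall (a : U) (b : El a -> U),
    Equiv (El (pi_name b)) (forall x : El a, El (b x));
  El_sigma : forall (a : U) (b : El a -> U),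
    Equiv (El (sigma_name b)) {x : El a & El (b x)};
  El_w : forall (a : U) (b : El a -> U),
    Equiv (El (w_name b)) (W (fun x : El a => El (b x)));
  El_id : forall (a : U) (b c : El a), Equiv (El (id_name b c)) (Id b c);
  El_plus : forall a b : U, Equiv (El (plus_name a b)) (El a + El b);
  El_nat : Equiv (El nat_name) nat;
  El_fin : forall k : nat, Equiv (El (fin_name k)) (Fin.t k)
}.

Definition V (T : WeakTarskiUniverse) : Type := W (El T).

Definition bar (T : WeakTarskiUniverse) (alpha : V T) : U T :=
  match alpha with @sup _ _ a _ => a end.

Definition tilde (T : WeakTarskiUniverse) (alpha : V T) :
    El T (bar alpha) -> V T :=
  match alpha return El T (bar alpha) -> V T with @sup _ _ _ f => f end.

Fixpoint exteq (T : WeakTarskiUniverse) (alpha beta : V T) : Type :=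
  match alpha, beta with
  | @sup _ _ a f, @sup _ _ b g =>
      ((forall x : El T a, {y : El T b & exteq (f x) (g y)}) *
       (forall y : El T b, {x : El T a & exteq (f x) (g y)}))%type
  end.

(* First-order formulae over constants C, with n free variables; variables are
   de Bruijn indices and F1 is the most recently bound one.  In AllIn t phi and
   ExIn t phi the bound t lies outside the scope of the bound variable. *)
Inductive term (C : Type) (n : nat) : Type :=
| Var : Fin.t n -> term C n
| Const : C -> term C n.

Inductive formula (C : Type) : nat -> Type :=
| Bot : forall n, formula C n
| Mem : forall n, term C n -> term C n -> formula C n
| Eq : forall n, term C n -> term C n -> formula C n
| And : forall n, formula C n -> formula C n -> formula C n
| Or : forall n, formula C n -> formula C n -> formula C n
| Imp : forall n, formula C n -> formula C n -> formula C n
| All : forall n, formula C (S n) -> formula C n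
| Ex : forall n, formula C (S n) -> formula C n
| AllIn : forall n, term C n -> formula C (S n) -> formula C n
| ExIn : forall n, term C n -> formula C (S n) -> formula C n.

Bind Scope czf_scope with formula.
Infix "\in" := Mem (at level 70, no associativity) : czf_scope.
Infix "==" := Eq (at level 70, no associativity) : czf_scope.
Infix "/\" := And : czf_scope.
Infix "\/" := Or : czf_scope.
Infix "->" := Imp : czf_scope.

Fixpoint closure (C : Type) (n : nat) : formula C n -> formula C 0 :=
  match n with
  | O => fun phi => phi
  | S m => fun phi => closure (All phi)
  end.

(* Environments replace the substitution of constants for bound variables. *)
Definition env (T : WeakTarskiUniverse) (n : nat) : Type := Fin.t n -> V T.

Definition empty_env (T : WeakTarskiUniverse) : env T 0 :=
  fun k => Fin.case0 (fun _ => V T) k.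

Definition extend (T : WeakTarskiUniverse) (n : nat) (alpha : V T)
    (rho : env T n) : env T (S n) :=
  fun k => Fin.caseS' k (fun _ => V T) alpha rho.

Definition eval (T : WeakTarskiUniverse) (n : nat) (rho : env T n)
    (t : term (V T) n) : V T :=
  match t with
  | Var _ k => rho k
  | Const _ alpha => alpha
  end.

Fixpoint interp (T : WeakTarskiUniverse) (n : nat) (phi : formula (V T) n) :
    env T n -> Type :=
  match phi in formula _ n return env T n -> Type with
  | Bot _ _ => fun _ => Fin.t 0
  | Mem s t => fun rho =>
      {y : El T (bar (eval rho t)) & exteq (eval rho s) (tilde (eval rho t) y)}
  | Eq s t => fun rho => exteq (eval rho s) (eval rho t)
  | And p q => fun rho => (interp p rho * interp q rho)%type
  | Or p q => fun rho => (interp p rho + interp q rho)%type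
  | Imp p q => fun rho => interp p rho -> interp q rho
  | All p => fun rho => forall alpha : V T, interp p (extend alpha rho)
  | Ex p => fun rho => {alpha : V T & interp p (extend alpha rho)}
  | AllIn t p => fun rho =>
      forall x : El T (bar (eval rho t)),
        interp p (extend (tilde (eval rho t) x) rho)
  | ExIn t p => fun rho =>
      {x : El T (bar (eval rho t)) &
        interp p (extend (tilde (eval rho t) x) rho)}
  end.

(* Proof-relevant: an element of this type is an inhabitant of the
   interpretation. *)
Definition Valid (T : WeakTarskiUniverse) (n : nat) (phi : formula (V T) n) :
    Type :=
  interp (closure phi) (@empty_env T).

Definition lift (C : Type) (n : nat) (t : term C n) : term C (S n) :=
  match t with
  | Var _ k => Var C (Fin.FS k)
  | Const _ c => Const _ c
  end.

Definition v0 (C : Type) (n : nat) : term C (S n) := Var C Fin.F1.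
Definition v1 (C : Type) (n : nat) : term C (S (S n)) := lift (v0 C n).
Arguments v0 {C n}.
Arguments v1 {C n}.

Section SetNotions.
Variables (C : Type).
Local Open Scope czf_scope.

Definition Iff (n : nat) (p q : formula C n) : formula C n :=
  (p -> q) /\ (q -> p).

Definition Subset (n : nat) (x y : term C n) : formula C n :=
  AllIn x (v0 \in lift y).

(* z = {x, y} *)
Definition IsUPair (n : nat) (z x y : term C n) : formula C n :=
  All (Iff (v0 \in lift z) (v0 == lift x \/ v0 == lift y)).

(* p = <x, y>, with v1 = {x} and v0 = {x, y} *)
Definition IsOPair (n : nat) (p x y : term C n) : formula C n :=
  Ex (Ex (IsUPair v1 (lift (lift x)) (lift (lift x)) /\
          IsUPair v0 (lift (lift x)) (lift (lift y)) /\
          IsUPair (lift (lift p)) v1 v0)).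

(* <x, y> \in R *)
Definition OPairIn (n : nat) (x y R : term C n) : formula C n :=
  ExIn R (IsOPair v0 (lift x) (lift y)).

(* R is a subset of the cartesian product of a and A *)
Definition SubsetProd (n : nat) (R a A : term C n) : formula C n :=
  AllIn R (ExIn (lift a) (ExIn (lift (lift A))
    (IsOPair (lift v1) v1 v0))).

Definition Transitive (n : nat) (A : term C n) : formula C n :=
  AllIn A (Subset v0 (lift A)).

(* (forall x in a) (exists y in b) <x, y> \in R *)
Definition Total (n : nat) (R a b : term C n) : formula C n :=
  AllIn a (ExIn (lift b) (OPairIn v1 v0 (lift (lift R)))).

(* (forall y in b) (exists x in a) <x, y> \in R *)
Definition Onto (n : nat) (R a b : term C n) : formula C n :=
  AllIn b (ExIn (lift a) (OPairIn v0 v1 (lift (lift R)))).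

(* In the second conjunct v1 is a and v0 is R; inside ExIn, v0 is b. *)
Definition Regular (n : nat) (A : term C n) : formula C n :=
  Transitive A /\
  AllIn A (All (
    SubsetProd v0 v1 (lift (lift A)) ->
    AllIn v1 (Ex (OPairIn v1 v0 (lift (lift v0)))) ->
    ExIn (lift (lift A))
      (Total (lift v0) (lift v1) v0 /\ Onto (lift v0) (lift v1) v0))).

Definition REA : formula C 0 := All (Ex (Subset v1 v0 /\ Regular v0)).

End SetNotions.

(* Main.v *)
(** The branching types [bar beta], for [beta] ranging over [alpha] and its
    hereditary elements, form a family [b : El a -> U].  The type of trees
    [W x : El a. El (b x)] has a name, and reading each tree as an iterative set
    gives a set [A].  It is transitive because subtrees are trees, and each
    hereditary element of [alpha] is the image of a tree.  It is regular because
    an element of [A] is indexed by some [El (b x)]: type-theoretic choice turns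
    a total relation from it to [A] into a map from [El (b x)] to trees, and the
    tree with root [x] and these immediate subtrees is the required bound. *)
Require Import Defs.

Set Implicit Arguments.
Unset Strict Implicit.

(* The defining property of the preimage is packaged as a substitution
   principle, so that it can be used under dependent types. *)
Lemma equiv_preimage (A B : Type) (e : Equiv A B) (y : B) :
  {x : A & forall P : B -> Type, P y -> P (projT1 e x)}.
Proof.
  destruct e as [f [l [h Hh]]]; exists (h y); intro P.
  exact (match Hh y in Id _ z return P z -> P (f (h y)) with
         | refl _ => fun u => u end).
Qed.

Section ExtensionalSets.
Variable T : WeakTarskiUniverse.

Lemma exteq_refl (x : V T) : exteq x x.
Proof. induction x as [a f IH]; split; intro i; exists i; apply IH. Qed.

Lemma exteq_sym (x y : V T) : exteq x y -> exteq y x.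
Proof.
  revert y; induction x as [a f IH]; intros [b g] [H1 H2]; split; intro i.
  - destruct (H2 i) as [j Hj]; exists j; apply IH, Hj.
  - destruct (H1 i) as [j Hj]; exists j; apply IH, Hj.
Qed.

Lemma exteq_trans (x y z : V T) : exteq x y -> exteq y z -> exteq x z.
Proof.
  revert y z; induction x as [a f IH].
  intros [b g] [c h] [H1 H2] [K1 K2]; split; intro i.
  - destruct (H1 i) as [j Hj]; destruct (K1 j) as [k Hk].
    exists k; exact (IH _ _ _ Hj Hk).
  - destruct (K2 i) as [j Hj]; destruct (H2 j) as [k Hk].
    exists k; exact (IH _ _ _ Hk Hj).
Qed.

Definition mem (x y : V T) : Type := {i : El T (bar y) & exteq x (tilde y i)}.

Lemma mem_exteq_r (x y z : V T) : mem x y -> exteq y z -> mem x z.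
Proof.
  destruct y as [b g], z as [c h]; intros [i Hi] [H1 _].
  destruct (H1 i) as [j Hj]; exists j; exact (exteq_trans Hi Hj).
Qed.

(** [is_upair] and [is_opair] match the interpretations of [IsUPair] and [IsOPair] by conversion, so
    lemmas about them apply directly to the interpreted axiom. *)
Definition is_upair (z x y : V T) : Type :=
  forall v : V T,
    ((mem v z -> exteq v x + exteq v y) * (exteq v x + exteq v y -> mem v z))%type.

Lemma is_upair_l (z x y : V T) : is_upair z x y -> mem x z.
Proof. intro H; apply H; left; apply exteq_refl. Qed.

Lemma is_upair_cong (z x x' y y' : V T) :
  exteq x x' -> exteq y y' -> is_upair z x y -> is_upair z x' y'.
Proof.
  intros Hx Hy H v; split.
  - intro Hv; destruct (fst (H v) Hv) as [E | E]; [left | right];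
      eapply exteq_trans; eassumption.
  - intros [E | E]; apply H; [left | right];
      (eapply exteq_trans; [exact E | apply exteq_sym; assumption]).
Qed.

Definition is_opair (p x y : V T) : Type :=
  {s : V T & {d : V T &
    (is_upair s x x * (is_upair d x y * is_upair p s d))%type}}.

Lemma is_opair_cong (p x x' y y' : V T) :
  exteq x x' -> exteq y y' -> is_opair p x y -> is_opair p x' y'.
Proof.
  intros Hx Hy (s & d & Hs & Hd & Hp); exists s, d; split; [| split].
  - exact (is_upair_cong Hx Hx Hs).
  - exact (is_upair_cong Hx Hy Hd).
  - exact Hp.
Qed.

Lemma mem_singleton (s x v : V T) : is_upair s x x -> mem v s -> exteq v x.
Proof. intros Hs Hv; destruct (fst (Hs v) Hv); assumption. Qed.

(** The singleton [s] is a member of [p], so it equals [s'] or [d']. In the first case [x] lies in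
    the singleton of [x']; in the second [x'], a member of [d'], lies in the singleton of [x]. *)
Lemma is_opair_inj_l (p x y x' y' : V T) :
  is_opair p x y -> is_opair p x' y' -> exteq x x'.
Proof.
  intros (s & d & Hs & Hd & Hp) (s' & d' & Hs' & Hd' & Hp').
  destruct (fst (Hp' s) (is_upair_l Hp)) as [E | E].
  - exact (mem_singleton Hs' (mem_exteq_r (is_upair_l Hs) E)).
  - apply exteq_sym, (mem_singleton Hs).
    exact (mem_exteq_r (is_upair_l Hd') (exteq_sym E)).
Qed.

Section TreeSets.
Variables (a : U T) (b : El T a -> U T).

Definition tree : Type := W (fun x : El T a => El T (b x)).

Fixpoint set_of_tree (t : tree) : V T :=
  match t with
  | sup x g => sup (b x) (fun y => set_of_tree (g y))
  end.

Definition tree_sets : V T :=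
  sup (w_name T a b) (fun i => set_of_tree (projT1 (El_w T a b) i)).

Lemma mem_tree_sets (t : tree) : mem (set_of_tree t) tree_sets.
Proof.
  destruct (equiv_preimage (El_w T a b) t) as [k Hk]; exists k.
  apply (Hk (fun s => exteq (set_of_tree t) (set_of_tree s))), exteq_refl.
Qed.

Lemma tree_sets_transitive (k : El T (bar tree_sets))
    (i : El T (bar (tilde tree_sets k))) :
  mem (tilde (tilde tree_sets k) i) tree_sets.
Proof.
  cbn in *; destruct (projT1 (El_w T a b) k) as [x g]; apply mem_tree_sets.
Qed.

Lemma tree_sets_strong_collection (k : El T (bar tree_sets))
    (R : V T -> V T -> Type) :
  (forall i : El T (bar (tilde tree_sets k)),
     {j : El T (bar tree_sets) &
       R (tilde (tilde tree_sets k) i) (tilde tree_sets j)}) ->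
  {l : El T (bar tree_sets) &
    ((forall i : El T (bar (tilde tree_sets k)),
        {j : El T (bar (tilde tree_sets l)) &
          R (tilde (tilde tree_sets k) i) (tilde (tilde tree_sets l) j)}) *
     (forall j : El T (bar (tilde tree_sets l)),
        {i : El T (bar (tilde tree_sets k)) &
          R (tilde (tilde tree_sets k) i) (tilde (tilde tree_sets l) j)}))%type}.
Proof.
  cbn; destruct (projT1 (El_w T a b) k) as [x g]; cbn; intro H.
  (* Position [i] of [t] carries the tree that [H] selects for [i], so [i] itself witnesses both
     halves of the conclusion. *)
  set (t := @sup _ (fun x => El T (b x)) x
              (fun i => projT1 (El_w T a b) (projT1 (H i)))).
  destruct (equiv_preimage (El_w T a b) t) as [l Hl]; exists l.
  apply (Hl (fun s =>
    ((forall i, {j : El T (bar (set_of_tree s)) &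
        R (set_of_tree (g i)) (tilde (set_of_tree s) j)}) *
     (forall j : El T (bar (set_of_tree s)),
        {i & R (set_of_tree (g i)) (tilde (set_of_tree s) j)}))%type)).
  split; intro i; exists i; exact (projT2 (H i)).
Qed.

(** Names are compared by identity in [U]: eliminating it turns the branching type of a node into
    [El T (b i)], that of a tree node. *)
Fixpoint hereditarily_labelled (x : V T) : Type :=
  match x with
  | sup c f =>
      ({i : El T a & Id (b i) c} * (forall j, hereditarily_labelled (f j)))%type
  end.

Lemma set_of_tree_surjective (x : V T) :
  hereditarily_labelled x -> {t : tree & exteq x (set_of_tree t)}.
Proof.
  induction x as [c f IH]; intros [[i p] H]; destruct p.
  exists (@sup _ (fun x => El T (b x)) i (fun j => projT1 (IH j (H j)))).
  split; intro j; exists j; exact (projT2 (IH j (H j))).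
Qed.

End TreeSets.

(** Serves to enlarge the labelling of one element to a common labelling for the whole set. *)
Lemma hereditarily_labelled_mono (a a' : U T) (b : El T a -> U T)
    (b' : El T a' -> U T) (x : V T) :
  (forall i, {i' : El T a' & Id (b' i') (b i)}) ->
  hereditarily_labelled b x -> hereditarily_labelled b' x.
Proof.
  intro Hb; induction x as [c f IH]; intros [[i p] H]; destruct p; split.
  - exact (Hb i).
  - intro j; exact (IH j (H j)).
Qed.

(** By induction, [sup c f] takes one index for the root name [c], plus all pairs of a position [j]
    and a label index for [f j]. *)
Lemma hereditary_labels (x : V T) :
  {a : U T & {b : El T a -> U T & hereditarily_labelled b x}}.
Proof.
  induction x as [c f IH].
  set (s := sigma_name T c (fun j => projT1 (IH j))).
  set (e := El_plus T (fin_name T 1) s).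
  set (es := El_sigma T c (fun j => projT1 (IH j))).
  set (label := fun q : El T (fin_name T 1) + El T s =>
    match q with
    | inl _ => c
    | inr r => let (j, i) := projT1 es r in projT1 (projT2 (IH j)) i
    end).
  exists (plus_name T (fin_name T 1) s), (fun i => label (projT1 e i)); split.
  - destruct (equiv_preimage (El_fin T 1) Fin.F1) as [z _].
    destruct (equiv_preimage e (inl z)) as [i Hi]; exists i.
    apply (Hi (fun q => Id (label q) c)); constructor.
  - intro j; refine (hereditarily_labelled_mono _ (projT2 (projT2 (IH j)))).
    intro k.
    destruct (equiv_preimage es (existT _ j k)) as [r Hr].
    destruct (equiv_preimage e (inr r)) as [i Hi]; exists i.
    apply (Hi (fun q => Id (label q) _)); cbn.
    apply (Hr (fun p => Id (let (j, i) := p in projT1 (projT2 (IH j)) i) _)).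
    constructor.
Qed.

End ExtensionalSets.

Theorem theorem6p13 (fe : Funext) (T : WeakTarskiUniverse) :
  Valid (REA (V T)).
Proof.
  intro alpha.
  destruct (hereditary_labels alpha) as [a [b Hb]].
  exists (tree_sets b); split; [| split].
  (* [snd Hb] labels each element [f i] hereditarily, so [f i] is the set of some tree. *)
  - destruct alpha as [c f]; intro i.
    destruct (set_of_tree_surjective (snd Hb i)) as [t Ht].
    destruct (mem_tree_sets t) as [j Hj]; exists j; exact (exteq_trans Ht Hj).
  - exact (@tree_sets_transitive T a b).
  - intros k R HR Htot.
    apply (@tree_sets_strong_collection T a b k (fun x y =>
      {r : El T (bar R) & is_opair (tilde R r) x y})).
    intro i; destruct (Htot i) as (y & r & Hr).
    (* [Hr] pairs the element at [i] with an arbitrary set [y]. By [HR] the same pair has components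
       at [i'] and at [j], the latter in [tree_sets b]; injectivity replaces [i'] by [i]. *)
    destruct (HR r) as (i' & j & Hr'); exists j, r.
    exact (is_opair_cong (is_opair_inj_l Hr' Hr) (exteq_refl _) Hr').
Qed.
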